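(* Let $p\in\mathbb R^{3\times 5}$ be a 5-point configuration, with columns $p_1,\dots,p_5$, and let $q=(p_1\ p_4\ p_5)$ and $r=(p_1\ p_2\ p_3)$ be the $3\times 3$ matrices obtained from $p$ by deleting, respectively, the second and third columns and the fourth and fifth columns. Suppose that $q$ and $r$ are invertible and that $(r^{-1}q)^T\mathbf 1\neq\mathbf 1$, where $\mathbf 1\in\mathbb R^3$ is the all-ones column vector. Suppose that $S$ is a two dimensional $p$-admissible linear subspace of $\mathbb R^{3\times 5}$. Then at least one of the following statements is true. (1) Every element of $S$ is an affine motion of $p$. (2) $S$ is $p$-equivalent to a subspace $S'$ of the form $S'=Ez^T=\{cz^T: c\in E\}$ for some two dimensional linear subspace $E$ of $\mathbb R^3$ and some $z\in\mathbb R^5$.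
   Context: For a matrix $p$, $p_i$ denotes its $i$th column. A motion of $p\in\mathbb R^{n\times k}$ is any matrix $u\in\mathbb R^{n\times k}$. Let $\mathcal I_p\subset\mathbb R^{n\times k}$ be the space of infinitesimal isometries of $p$, i.e. of those $u$ with $(u_i-u_j)^T(p_i-p_j)=0$ for all $i,j$; equivalently $u=t\mathbf 1^T+ap$ for some $t\in\mathbb R^n$ and skew symmetric $a\in\mathbb R^{n\times n}$. A motion $u$ of $p$ is affine if there are $m\in\mathbb R^{n\times n}$, $b\in\mathbb R^n$ with $u_i=mp_i+b$ for all $i$. Linear subspaces $S,S'$ of $\mathbb R^{n\times k}$ are $p$-equivalent if they have the same dimension and the same image under the projection $\mathbb R^{n\times k}\to\mathbb R^{n\times k}/\mathcal I_p$. Let $k\ge n+1$. A linear subspace $S\le\mathbb R^{n\times k}$ is $p$-admissible if (i) $S\cap\mathcal I_p=0$, and (ii) for almost all $x\in\mathbb R^n$ there are a non-zero $u\in S$ and a vector $y\in\mathbb R^n$ such that $(u_i-y)^T(p_i-x)=0$ for all $i=1,\dots,k$ (that is, $u$ is the restriction to $p$ of an infinitesimal flex of the framework on the complete bipartite graph $K_{k,1}$ with the $k$ vertices placed at $p_1,\dots,p_k$ and the remaining vertex placed at $x$). ''For almost all $x$'' means for all $x$ in some open dense subset of $\mathbb R^n$. *)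

(* Defs.v *)
From HB Require Import structures.
From mathcomp Require Import all_boot all_order all_algebra.
From mathcomp Require Import all_classical all_reals all_analysis.
Import Order.TTheory GRing.Theory Num.Theory.
Import numFieldNormedType.Exports.

Set Implicit Arguments.
Unset Strict Implicit.
Unset Printing Implicit Defensive.

Local Open Scope classical_set_scope.
Local Open Scope ring_scope.

(* A configuration of k points in R^n, and a motion of it, are n x k matrices
   whose columns are the points, respectively the velocities. *)

Section Motions.
Variables (R : realType) (n k : nat).
Implicit Types (p u : 'M[R]_(n, k)) (S : {vspace 'M[R]_(n, k)}).

Definition edge_form p (i j : 'I_k) u : 'M[R]_1 :=
  (col i u - col j u)^T *m (col i p - col j p).

Fact edge_form_is_linear p i j : linear (edge_form p i j).
Proof.
move=> a u v; rewrite /edge_form.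
have -> : col i (a *: u + v) - col j (a *: u + v) =
          a *: (col i u - col j u) + (col i v - col j v).
  by apply/colP => l; rewrite !mxE mulrBr opprD addrACA.
by rewrite linearP mulmxDl scalemxAl.
Qed.

HB.instance Definition _ p i j :=
  GRing.isLinear.Build R 'M[R]_(n, k) 'M[R]_1 _ (edge_form p i j)
    (edge_form_is_linear p i j).

Definition inf_isometries p : {vspace 'M[R]_(n, k)} :=
  (\bigcap_(i < k) \bigcap_(j < k) lker (linfun (edge_form p i j)))%VS.

Lemma inf_isometriesP p u :
  reflect (forall i j, (col i u - col j u)^T *m (col i p - col j p) = 0)
          (u \in inf_isometries p).
Proof.
rewrite memvE.
apply: (iffP subv_bigcapP) => [uI i j|uI i _].
  have /subv_bigcapP/(_ j isT) := uI i isT.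
  by rewrite -memvE memv_ker lfunE => /eqP.
by apply/subv_bigcapP => j _; rewrite -memvE memv_ker lfunE; apply/eqP/uI.
Qed.

Definition affine_motion p u : Prop :=
  exists (m : 'M[R]_n) (b : 'cV[R]_n), forall i, col i u = m *m col i p + b.

(* The coset u + I_p, i.e. the image of u in the quotient by I_p. *)
Definition isometry_class p u : set 'M[R]_(n, k) :=
  [set v | v - u \in inf_isometries p].

Definition p_equivalent p S S' : Prop :=
  \dim S = \dim S' /\
  isometry_class p @` [set` S] = isometry_class p @` [set` S'].

Definition almost_all (P : 'cV[R]_n -> Prop) : Prop :=
  exists U : set 'cV[R]_n, [/\ open U, dense U & forall x, U x -> P x].

(* Used for k >= n + 1. *)
Definition p_admissible p S : Prop :=
  (S :&: inf_isometries p = 0)%VS /\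
  almost_all (fun x => exists (u : 'M[R]_(n, k)) (y : 'cV[R]_n),
    [/\ u \in S, u != 0 &
        forall i, (col i u - y)^T *m (col i p - x) = 0]).

End Motions.

(* Main.v *)
Require Import Defs.
From HB Require Import structures.
From mathcomp Require Import all_boot all_order all_algebra.
From mathcomp Require Import all_classical all_reals all_analysis.
From mathcomp Require Import ring lra.
Import Order.TTheory GRing.Theory Num.Theory.
Import numFieldNormedType.Exports.

Set Implicit Arguments.
Unset Strict Implicit.
Unset Printing Implicit Defensive.

Local Open Scope classical_set_scope.
Local Open Scope ring_scope.

(* One of p_4, p_5 lies off the plane of p_1, p_2, p_3, so all points but one,
   p_l, form an affine basis.  Write x in barycentric coordinates t with respect
   to it, let dep be the affine dependency of the points with dep_l = -1, and put
     Q_u(t) = \sum_{j <> l} t_j u_j . (p_j - x),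
     L_u(t) = \sum_i dep_i u_i . (p_i - x).
   Eliminating y shows that a flex (u, y) at x satisfies Q_u = L_u = 0 at t.
   Since dim S = 2, admissibility makes Q_u L_v - Q_v L_u vanish at almost every
   x, hence identically, for all u, v in S.  If L vanishes on S, every u in S
   respects the dependency and is affine.  Otherwise the forms L_u are linearly
   independent and Q_u = L_u K with one linear form K for all u.  Comparing
   coefficients, u is congruent modulo I_p to (\sum_i dep_i u_i) z^T, where
   z_j = K(p_j) for j <> l and z_l = K(p_l) - 1. *)

(** * Two-dimensional subspaces *)

Section Planes.
Variables (K : fieldType) (vT : vectType K) (S : {vspace vT}).
Hypothesis S_dim : \dim S = 2%N.

Lemma plane_notin_line (w : vT) : exists2 v, v \in S & v \notin <[w]>%VS.
Proof.
have : ~~ (S <= <[w]>)%VS.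
  by apply/negP => /dimvS; rewrite S_dim dim_vline; case: (w != 0).
by case/subvPn => v vS vw; exists v.
Qed.

Lemma plane_coord (w : vT) : w \in S -> w != 0 ->
  exists2 w', w' \in S &
    forall u, u \in S -> exists a b : K, u = a *: w + b *: w'.
Proof.
move=> wS w0; have [w' w'S w'w] := plane_notin_line w.
exists w' => // u uS.
have /span_basis SE : basis_of S [:: w'; w].
  rewrite basisEfree free_cons seq1_free span_seq1 w0 w'w S_dim leqnn /= andbT.
  by apply/span_subvP => x; rewrite !inE => /orP[]/eqP ->.
move: uS; rewrite -SE span_cons span_seq1.
case/memv_addP => _ /vlineP[b ->] [_ /vlineP[a ->] ->].
by exists a, b; rewrite addrC.
Qed.

End Planes.

(** * Products and common factors of linear and quadratic forms *)

Section Forms.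
Variables (R : realFieldType) (m : nat).
Implicit Types (G : 'M[R]_m) (L : 'rV[R]_m) (s t : 'cV[R]_m).

Definition linear_form L t : R := (L *m t) 0 0.
Definition quad_form G t : R := (t^T *m G *m t) 0 0.
(** The coefficient of [x] in [quad_form G (s + x *: t)]; both orders occur because [G] need not be
    symmetric. *)
Definition polar_form G s t : R := (s^T *m G *m t + t^T *m G *m s) 0 0.

Lemma linear_formD L s t x :
  linear_form L (s + x *: t) = linear_form L s + x * linear_form L t.
Proof. by rewrite /linear_form linearD linearZ !mxE. Qed.

Lemma linear_form0 t : linear_form 0 t = 0.
Proof. by rewrite /linear_form mul0mx mxE. Qed.

Lemma quad_form0 t : quad_form 0 t = 0.
Proof. by rewrite /quad_form mulmx0 mul0mx mxE. Qed.

Lemma linear_formDl L L' t x :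
  linear_form (x *: L + L') t = x * linear_form L t + linear_form L' t.
Proof. by rewrite /linear_form mulmxDl -scalemxAl !mxE. Qed.

Lemma quad_formDl G G' t x :
  quad_form (x *: G + G') t = x * quad_form G t + quad_form G' t.
Proof. by rewrite /quad_form mulmxDr mulmxDl -scalemxAr -scalemxAl !mxE. Qed.

Lemma linear_formBl L L' t x :
  linear_form (L - x *: L') t = linear_form L t - x * linear_form L' t.
Proof. by rewrite /linear_form mulmxBl -scalemxAl !mxE. Qed.

Lemma linear_formZ L t x : linear_form L (x *: t) = x * linear_form L t.
Proof. by rewrite /linear_form linearZ mxE. Qed.

Lemma quad_formZ G t x : quad_form G (x *: t) = x ^+ 2 * quad_form G t.
Proof.
rewrite /quad_form; have -> : (x *: t)^T = x *: t^T by rewrite linearZ.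
by rewrite -!scalemxAl -scalemxAr scalerA mxE.
Qed.

Lemma quad_formD G s t x :
  quad_form G (s + x *: t) =
  quad_form G s + x * polar_form G s t + x ^+ 2 * quad_form G t.
Proof.
rewrite /quad_form /polar_form.
have -> : (s + x *: t)^T = s^T + x *: t^T by rewrite linearD linearZ.
rewrite !mulmxDl !mulmxDr -!scalemxAl -!scalemxAr.
rewrite !mxE; ring.
Qed.

Lemma linear_form_eq0 L : (forall t, linear_form L t = 0) -> L = 0.
Proof.
move=> L0; apply/rowP => j; have := L0 (delta_mx j 0).
by rewrite /linear_form -colE !mxE.
Qed.

Lemma linear_form_neq0 L : L != 0 -> exists t, linear_form L t = 1.
Proof.
case/rV0Pn => j Lj; pose t : 'cV[R]_m := delta_mx j 0.
have Lt : linear_form L t != 0 by rewrite /linear_form -colE !mxE.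
exists ((linear_form L t)^-1 *: t).
by rewrite linear_formZ mulVf.
Qed.

(** [L] vanishes at [t0]. If it did not vanish at some [s] of the hyperplane, then along the line
    [t0 + x *: s] it would be zero only at [x = 0], so the quadratic form would vanish at every
    other point of that line. *)
Lemma quad_linear_prod0 A G L t0 :
    (forall t, linear_form A t = 0 -> quad_form G t * linear_form L t = 0) ->
    linear_form A t0 = 0 -> quad_form G t0 != 0 ->
  forall t, linear_form A t = 0 -> linear_form L t = 0.
Proof.
move=> GL At0 Gt0 s As; apply/eqP; apply: contraT => Ls.
have Lt0 : linear_form L t0 = 0.
  by have /eqP := GL t0 At0; rewrite mulf_eq0 (negPf Gt0) => /eqP.
have G0 x : x != 0 -> quad_form G (t0 + x *: s) = 0.
  move=> x0; have := GL (t0 + x *: s).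
  rewrite linear_formD At0 As mulr0 addr0 => /(_ erefl)/eqP.
  rewrite linear_formD Lt0 add0r !mulf_eq0 (negPf x0) (negPf Ls) !orbF.
  by move/eqP.
(* Three zeros kill a polynomial of degree two, in particular its constant term [quad_form G t0]. *)
have := G0 1; have := G0 (-1); have := G0 2.
rewrite !quad_formD oppr_eq0 oner_eq0 pnatr_eq0.
move=> /(_ isT) E1 /(_ isT) E2 /(_ isT) E3.
case/eqP: Gt0; lra.
Qed.

Lemma quad_linear_prod0_full G L :
    (forall t, quad_form G t * linear_form L t = 0) -> L != 0 ->
  forall t, quad_form G t = 0.
Proof.
move=> GL L0 t; apply/eqP; apply: contraT => Gt; case/eqP: L0.
apply: linear_form_eq0 => s.
by apply: (@quad_linear_prod0 0 G L t) => // *; exact: linear_form0.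
Qed.

(** With [A a = 1], the vector [t - A(t) a] lies in the hyperplane; expanding the quadratic form
    there exhibits the factor [A(t)]. *)
Lemma quad_form_factor A G :
    A != 0 -> (forall t, linear_form A t = 0 -> quad_form G t = 0) ->
  exists K, forall t, quad_form G t = linear_form A t * linear_form K t.
Proof.
move=> A0 GA; have [a Aa] := linear_form_neq0 A0.
exists (a^T *m (G + G^T) - quad_form G a *: A) => t.
have At x : linear_form A (t + x *: a) = linear_form A t + x.
  by rewrite linear_formD Aa mulr1.
have := GA (t + - linear_form A t *: a); rewrite At subrr => /(_ erefl).
rewrite quad_formD => /eqP; rewrite -addrA addr_eq0 => /eqP ->.
have -> : linear_form (a^T *m (G + G^T) - quad_form G a *: A) t =
          polar_form G t a - quad_form G a * linear_form A t.
  rewrite /linear_form /polar_form mulmxBl mulmxDr mulmxDl -scalemxAl.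
  have -> : a^T *m G^T *m t = (t^T *m G *m a)^T by rewrite !trmx_mul trmxK mulmxA.
  by rewrite !mxE; congr (_ - _); rewrite addrC.
ring.
Qed.

(** A factor [K] is found for [a] alone, by showing that [G a] vanishes wherever [L a] does. The
    same [K] then serves every [u], because the product of [G u - L u * K] with the non-zero form
    [L a] is zero. *)
Lemma pencil_factor (vT : vectType R) (S : {vspace vT})
    (G : vT -> 'M[R]_m) (L : {linear vT -> 'rV[R]_m}) (a : vT) :
    \dim S = 2%N ->
    (forall u, u \in S -> L u = 0 -> (forall t, quad_form (G u) t = 0) -> u = 0) ->
    (forall u v t, u \in S -> v \in S ->
       quad_form (G u) t * linear_form (L v) t =
       quad_form (G v) t * linear_form (L u) t) ->
    a \in S -> L a != 0 ->
  exists K, forall u t, u \in S ->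
    quad_form (G u) t = linear_form (L u) t * linear_form K t.
Proof.
move=> S_dim inj0 GL aS La0.
have Lker u : u \in S -> L u = 0 -> u = 0.
  move=> uS Lu; apply: inj0 => //; apply: (quad_linear_prod0_full (L := L a)) => // t.
  by rewrite GL // Lu linear_form0 mulr0.
have [K KP] : exists K, forall t,
    quad_form (G a) t = linear_form (L a) t * linear_form K t.
  apply: quad_form_factor => // t0 At0; apply/eqP; apply: contraT => Gt0.
  have [b Lb] := linear_form_neq0 La0.
  have [v vS va] := plane_notin_line S_dim a.
  (* The correction makes [L u] vanish at [b], a point off the hyperplane [L a = 0]. As [G a] is
     non-zero at [t0], [L u] vanishes on that hyperplane too, so [u = 0] and [v] would be a multiple
     of [a]. *)
  pose u := v - linear_form (L v) b *: a.
  have uS : u \in S by rewrite rpredB ?rpredZ.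
  have u0 : u = 0.
    apply: Lker => //; apply: linear_form_eq0 => t.
    have Lub : linear_form (L u) b = 0.
      by rewrite /u linearB linearZ linear_formBl Lb mulr1 subrr.
    have := @quad_linear_prod0 (L a) (G a) (L u) t0 _ At0 Gt0
      (t + - linear_form (L a) t *: b).
    rewrite !linear_formD Lb Lub mulr0 addr0 mulr1 subrr; apply=> //.
    by move=> s As; rewrite GL // As mulr0.
  by case/negP: va; apply/vlineP; exists (linear_form (L v) b);
    apply/eqP; rewrite -subr_eq0 -/u u0.
exists K => u t uS; apply/eqP; rewrite -subr_eq0; apply/eqP.
have GE s : quad_form (G u - (L u)^T *m K) s =
            quad_form (G u) s - linear_form (L u) s * linear_form K s.
  rewrite /quad_form /linear_form mulmxBr mulmxBl.
  have -> : s^T *m ((L u)^T *m K) *m s = (L u *m s)^T *m (K *m s).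
    by rewrite trmx_mul !mulmxA.
  by rewrite !(mxE, big_ord1).
rewrite -GE; apply: (quad_linear_prod0_full (L := L a)) => // s.
by rewrite GE mulrBl GL // KP; ring.
Qed.

End Forms.

(** * The Euclidean inner product *)

Section Dot.
Variables (R : realFieldType) (n : nat).
Implicit Types a b c : 'cV[R]_n.

Definition dot a b : R := (a^T *m b) 0 0.

Lemma dotC a b : dot a b = dot b a.
Proof. by rewrite /dot !mxE; apply: eq_bigr => i _; rewrite !mxE mulrC. Qed.

Lemma dotBr a b c : dot a (b - c) = dot a b - dot a c.
Proof. by rewrite /dot linearB !mxE. Qed.

Lemma dotBl a b c : dot (a - b) c = dot a c - dot b c.
Proof. by rewrite ![dot _ c]dotC dotBr. Qed.

Lemma dotNr a b : dot a (- b) = - dot a b.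
Proof. by rewrite /dot linearN !mxE. Qed.

Lemma dot0r a : dot a 0 = 0.
Proof. by rewrite /dot mulmx0 mxE. Qed.

Lemma dotDl a b c : dot (a + b) c = dot a c + dot b c.
Proof. by rewrite ![dot _ c]dotC /dot linearD !mxE. Qed.

Lemma dotZl x a b : dot (x *: a) b = x * dot a b.
Proof. by rewrite dotC /dot linearZ mxE -/(dot b a) dotC. Qed.

Lemma dot_mulmx m (A : 'M[R]_(n, m)) (t : 'cV[R]_m) a :
  dot a (A *m t) = \sum_j t j 0 * dot a (col j A).
Proof.
rewrite /dot mulmxA mxE; apply: eq_bigr => j _.
by rewrite mulrC [col j A]colE mulmxA -colE [col j _ 0 0]mxE.
Qed.

Lemma dot_eq0 a b : reflect (dot a b = 0) (a^T *m b == 0).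
Proof.
apply: (iffP eqP) => [ab|ab]; first by rewrite /dot ab mxE.
by apply/matrixP => i j; rewrite !ord1 -/(dot a b) [RHS]mxE.
Qed.

End Dot.

(** * Barycentric coordinates and the two forms of a motion *)

Section Barycentric.
Variables (R : realType) (n : nat) (p : 'M[R]_(n, n.+2)) (l : 'I_n.+2).
Local Notation P := (col' l p : 'M[R]_(n, n.+1)).
Local Notation pt i := (col i p).
Local Notation H := (col_mx (const_mx 1 : 'rV[R]_n.+1) P : 'M[R]_n.+1).
Hypothesis H_unit : H \in unitmx.
Implicit Types (u : 'M[R]_(n, n.+2)) (x y : 'cV[R]_n) (t : 'cV[R]_n.+1).

(** The row of ones in [H] makes the coordinates sum to one; the rows of [P] make them average the
    points to [x]. *)
Definition bary x : 'cV[R]_n.+1 :=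
  invmx H *m (col_mx 1 x : 'cV[R]_(1 + n)).

Lemma mul_bary x : P *m bary x = x /\ const_mx 1 *m bary x = 1 :> 'M[R]_1.
Proof.
have : (col_mx (const_mx 1) P : 'M[R]_(1 + n, n.+1)) *m bary x = col_mx 1 x.
  exact: mulKVmx H_unit _.
by rewrite mul_col_mx => /eq_col_mx[].
Qed.

Lemma sum_bary x : \sum_j bary x j 0 = 1.
Proof.
have /matrixP/(_ 0 0) := (mul_bary x).2.
rewrite mxE [RHS]mxE eqxx mulr1n => <-; apply: eq_bigr => j _.
by rewrite [const_mx _ _ _]mxE mul1r.
Qed.

Lemma sum_bary_dot a b x :
  \sum_j bary x j 0 * dot a (b - pt (lift l j)) = dot a (b - x).
Proof.
rewrite dotBr -{2}(mul_bary x).1 dot_mulmx -[dot a b]mul1r -(sum_bary x).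
rewrite mulr_suml -sumrB; apply: eq_bigr => j _; rewrite dotBr mulrBr.
by congr (_ - _ * dot a _); apply/colP => i; rewrite !mxE.
Qed.

(* The affine dependency of the points: [\sum_i dep i * p_i = 0] with
   [\sum_i dep i = 0], normalised by [dep l = -1]. *)
Definition dep : 'cV[R]_n.+2 :=
  \col_i oapp (fun j => bary (pt l) j 0) (-1) (unlift l i).

Lemma sum_dep (F : 'I_n.+2 -> R) : \sum_i dep i 0 * F i =
  \sum_j bary (pt l) j 0 * F (lift l j) - F l.
Proof.
rewrite (bigD1_ord l) //= mxE unlift_none /= mulN1r addrC.
by congr (_ - _); apply: eq_bigr => j _; rewrite mxE liftK.
Qed.

Lemma sum_dep_dot a b : \sum_i dep i 0 * dot a (pt i - b) = 0.
Proof.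
rewrite sum_dep -[pt l - b]opprB dotNr opprK -sum_bary_dot -big_split /=.
by rewrite big1 // => j _; rewrite -[_ - b]opprB dotNr mulrN addNr.
Qed.

(** The form [L_u]: an affine function of [x] becomes linear in coordinates of sum one, its
    coefficients being its values at the basis points. *)
Definition bary_linear u : 'rV[R]_n.+1 :=
  \row_k \sum_i dep i 0 * dot (col i u) (pt i - pt (lift l k)).

(** The form [Q_u] made homogeneous through [p_j - x = \sum_k t_k (p_j - p_k)]. Its diagonal is
    zero. *)
Definition bary_quad u : 'M[R]_n.+1 :=
  \matrix_(j, k) dot (col (lift l j) u) (pt (lift l j) - pt (lift l k)).

Lemma col_linear m k (i : 'I_k) : linear (@col R m k i).
Proof. by move=> a A B; apply/colP => j; rewrite !mxE. Qed.

Lemma bary_linear_is_linear : linear bary_linear.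
Proof.
move=> a u v; apply/rowP => k; rewrite !mxE mulr_sumr -big_split /=.
apply: eq_bigr => i _; rewrite col_linear dotDl dotZl; ring.
Qed.

HB.instance Definition _ := GRing.isLinear.Build R 'M[R]_(n, n.+2)
  'rV[R]_n.+1 *:%R bary_linear bary_linear_is_linear.

Lemma bary_quad_is_linear : linear bary_quad.
Proof.
by move=> a u v; apply/matrixP => j k; rewrite !mxE col_linear dotDl dotZl.
Qed.

HB.instance Definition _ := GRing.isLinear.Build R 'M[R]_(n, n.+2)
  'M[R]_n.+1 *:%R bary_quad bary_quad_is_linear.

Lemma bary_linearE u x : linear_form (bary_linear u) (bary x) =
  \sum_i dep i 0 * dot (col i u) (pt i - x).
Proof.
rewrite /linear_form mxE.
under eq_bigr => k _ do rewrite mxE mulr_suml.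
rewrite exchange_big /=; apply: eq_bigr => i _.
rewrite -sum_bary_dot mulr_sumr; apply: eq_bigr => k _; ring.
Qed.

Lemma bary_quadE u x : quad_form (bary_quad u) (bary x) =
  \sum_j bary x j 0 * dot (col (lift l j) u) (pt (lift l j) - x).
Proof.
rewrite /quad_form -mulmxA mxE; apply: eq_bigr => j _.
rewrite !mxE -sum_bary_dot.
by congr (_ * _); apply: eq_bigr => k _; rewrite mxE mulrC.
Qed.

(** The coordinates of [p_l] are the coefficients of [dep] off [l], and at [x = p_l] the term
    [i = l] of [L_u] vanishes. *)
Lemma bary_quad_linear u :
  quad_form (bary_quad u) (bary (pt l)) = linear_form (bary_linear u) (bary (pt l)).
Proof. by rewrite bary_linearE sum_dep bary_quadE subrr dot0r subr0. Qed.

(** * Elimination of [y] from the flex equations *)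

Section Flex.
Variables (u : 'M[R]_(n, n.+2)) (x y : 'cV[R]_n).
Hypothesis flex : forall i, dot (col i u - y) (pt i - x) = 0.

Lemma flex_dot i : dot (col i u) (pt i - x) = dot y (pt i - x).
Proof. by apply/eqP; rewrite -subr_eq0 -dotBl flex. Qed.

(** The flex equations replace every [u_i] by the single vector [y], and the dependency annihilates
    [y . (p_i - x)]. *)
Lemma flex_bary_linear : linear_form (bary_linear u) (bary x) = 0.
Proof.
rewrite bary_linearE -[RHS](sum_dep_dot y x).
by apply: eq_bigr => i _; rewrite flex_dot.
Qed.

Lemma flex_bary_quad : quad_form (bary_quad u) (bary x) = 0.
Proof.
rewrite bary_quadE.
rewrite (eq_bigr (fun j => - (bary x j 0 * dot y (x - pt (lift l j))))).
  by rewrite sumrN sum_bary_dot subrr dot0r oppr0.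
by move=> j _; rewrite -mulrN -dotNr opprB -flex_dot.
Qed.

End Flex.

(** * Recovering a motion from its forms *)

Lemma dot_pts_eq0 e :
  (forall j k, dot e (pt (lift l j) - pt (lift l k)) = 0) -> e = 0.
Proof.
move=> e0.
(* Since [e] has the same inner product with all basis points, this row is annihilated by the
   invertible [H]. *)
pose w : 'rV[R]_(1 + n) := row_mx (dot e (pt (lift l 0)))%:M (- e^T).
have wH : w *m (col_mx (const_mx 1) P : 'M[R]_(1 + n, n.+1)) = 0.
  rewrite mul_row_col mul_scalar_mx; apply/rowP => k.
  rewrite mulNmx; move: (e0 0 k); rewrite dotBr => e0k.
  rewrite !mxE mulr1 -[RHS]e0k; congr (_ - _).
  by rewrite /dot mxE; apply: eq_bigr => i _; rewrite !mxE.
have /eqP : w = 0 by rewrite -[w](mulmxK (H_unit : H \in unitmx)) wH mul0mx.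
rewrite row_mx_eq0 oppr_eq0 => /andP[_ /eqP e0T].
by rewrite -[e]trmxK e0T trmx0.
Qed.

(** As a function of [x], [L_u] is affine with gradient [- u *m dep]. *)
Lemma bary_linear_diff u j k :
  bary_linear u 0 k - bary_linear u 0 j =
  dot (u *m dep) (pt (lift l j) - pt (lift l k)).
Proof.
rewrite !mxE -sumrB dotC dot_mulmx; apply: eq_bigr => i _.
rewrite -mulrBr -dotBr [X in _ = _ * X]dotC; congr (_ * dot _ _).
by rewrite opprB addrC addrA subrK.
Qed.

Lemma bary_linear_eq0 u : bary_linear u = 0 -> u *m dep = 0.
Proof.
by move=> Lu; apply: dot_pts_eq0 => j k; rewrite -bary_linear_diff Lu !mxE subrr.
Qed.

Lemma affine_motion_dep u : u *m dep = 0 -> affine_motion p u.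
Proof.
move=> ud.
(* [F] is the block row of [b] and [m] for the affine map interpolating [u] at the basis points. *)
pose F : 'M[R]_(n, 1 + n) := col' l u *m invmx H.
have FH : F *m (col_mx (const_mx 1) P : 'M[R]_(1 + n, n.+1)) = col' l u.
  exact: (mulmxKV (H_unit : H \in unitmx)).
have Fx x : lsubmx F + rsubmx F *m x = col' l u *m bary x.
  have -> : col' l u *m bary x = F *m (col_mx 1 x : 'M[R]_(1 + n, 1)).
    by rewrite /bary mulmxA.
  by rewrite -[F in RHS]hsubmxK mul_row_col mulmx1.
exists (rsubmx F), (lsubmx F) => i; rewrite addrC.
case: (unliftP l i) => [j|] ->; last first.
  (* At [p_l], the relation [u *m dep = 0] writes [u_l] as the combination of the other columns that
     the affine map takes there. *)
  have udr r : \sum_k dep k 0 * u r k = 0.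
    transitivity ((u *m dep) r 0); last by rewrite ud mxE.
    by rewrite mxE; apply: eq_bigr => k _; rewrite mulrC.
  apply/eqP; rewrite Fx eq_sym -subr_eq0; apply/eqP/colP => r.
  rewrite [RHS]mxE -[RHS](udr r) sum_dep 2!mxE; congr (_ + _).
    by apply: eq_bigr => k _; rewrite mxE mulrC.
  by rewrite !mxE.
rewrite -[F in lsubmx F]hsubmxK row_mxKl.
have := congr1 (col j) FH; rewrite -[F in F *m _]hsubmxK mul_row_col linearD /=.
rewrite !colE -!mulmxA -!colE => FHj.
have -> : col (lift l j) u = col j (col' l u) by apply/colP => r; rewrite !mxE.
have -> : col (lift l j) p = col j P by apply/colP => r; rewrite !mxE.
rewrite -FHj; congr (_ + _).
have -> : col j (const_mx 1 : 'rV[R]_n.+1) = 1.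
  by apply/matrixP => a b; rewrite !ord1 !mxE.
by rewrite mulmx1.
Qed.

(** Polarising [Q_u = L_u K] at two basis vectors gives the edge form of [u] on that edge. Edges at
    [l] follow from the dependency. On every edge the result is [(z_i - z_k) e . (p_i - p_k)], the
    edge form of [e *m z^T]. *)
Lemma edge_form_rank1 u (K : 'rV[R]_n.+1) :
    (forall t, quad_form (bary_quad u) t =
               linear_form (bary_linear u) t * linear_form K t) ->
  u - (u *m dep) *m (\col_i oapp (fun j => K 0 j)
        (linear_form K (bary (pt l)) - 1) (unlift l i))^T \in inf_isometries p.
Proof.
move=> GLK; set z := \col_i _; set e := u *m dep.
set L := bary_linear u in GLK *; set g := bary (pt l).
have lfE (M : 'rV[R]_n.+1) j : linear_form M (delta_mx j 0) = M 0 j.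
  by rewrite /linear_form -colE mxE.
have qfE j : quad_form (bary_quad u) (delta_mx j 0) = 0.
  by rewrite /quad_form -mulmxA -colE trmx_delta -rowE !mxE subrr dot0r.
have pfE j k : polar_form (bary_quad u) (delta_mx j 0) (delta_mx k 0) =
    dot (col (lift l j) u - col (lift l k) u) (pt (lift l j) - pt (lift l k)).
  rewrite /polar_form -!mulmxA -!colE !trmx_delta -!rowE !mxE dotBl.
  by rewrite -[pt (lift l k) - _]opprB dotNr.
have LK0 j : L 0 j * K 0 j = 0 by rewrite -!lfE -GLK qfE.
have LKE j k : dot (col (lift l j) u - col (lift l k) u)
    (pt (lift l j) - pt (lift l k)) = L 0 j * K 0 k + L 0 k * K 0 j.
  have := GLK (delta_mx j 0 + 1 *: delta_mx k 0).
  rewrite quad_formD !linear_formD !qfE pfE !lfE.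
  have := LK0 j; have := LK0 k; lra.
have eE j k : dot e (pt (lift l j) - pt (lift l k)) = L 0 k - L 0 j.
  by rewrite bary_linear_diff.
have lfg (M : 'rV[R]_n.+1) : linear_form M g = \sum_j g j 0 * M 0 j.
  by rewrite /linear_form mxE; apply: eq_bigr => j _; rewrite mulrC.
(* [Q_u] and [L_u] agree at [p_l]; this is what makes the shift by [-1] in [z_l] work. *)
have Lg_Kg : linear_form L g * (linear_form K g - 1) = 0.
  by rewrite mulrBr mulr1 -GLK bary_quad_linear subrr.
have zl : z l 0 = linear_form K g - 1 by rewrite mxE unlift_none.
have zlift j : z (lift l j) 0 = K 0 j by rewrite mxE liftK.
have elE k : dot e (pt l - pt (lift l k)) = L 0 k - linear_form L g.
  rewrite -opprB dotNr -sum_bary_dot -/g.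
  under eq_bigr => j _ do rewrite eE mulrBr.
  by rewrite sumrB -lfg -mulr_suml sum_bary mul1r opprB.
have lE k : dot (col l u - col (lift l k) u) (pt l - pt (lift l k)) =
    (z l 0 - z (lift l k) 0) * dot e (pt l - pt (lift l k)).
  (* Subtracting [u_k] from every [u_i] leaves [L 0 k] unchanged, so it is a combination of edge
     forms in which the edge from [l] to [k] has coefficient [-1]. *)
  have : L 0 k = \sum_j g j 0 * (L 0 j * K 0 k + L 0 k * K 0 j) -
      dot (col l u - col (lift l k) u) (pt l - pt (lift l k)).
    under eq_bigr => j _ do rewrite -LKE.
    rewrite -(sum_dep (fun i => dot (col i u - col (lift l k) u)
                                    (pt i - pt (lift l k)))).
    under eq_bigr => j _ do rewrite dotBl mulrBr.
    by rewrite sumrB sum_dep_dot subr0 mxE.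
  have -> : \sum_j g j 0 * (L 0 j * K 0 k + L 0 k * K 0 j) =
      linear_form L g * K 0 k + L 0 k * linear_form K g.
    rewrite !lfg mulr_suml mulr_sumr -big_split /=; apply: eq_bigr => j _; ring.
  rewrite zl zlift elE; have := LK0 k; lra.
have dotBC a b c d : dot (a - b) (c - d) = dot (b - a) (d - c) :> R.
  by rewrite -[a - b]opprB -[c - d]opprB dotNr dotC dotNr opprK dotC.
have edgeE i k : dot (col i u - col k u) (pt i - pt k) =
    (z i 0 - z k 0) * dot e (pt i - pt k).
  case: (unliftP l i) => [i'|] ->; case: (unliftP l k) => [k'|] ->.
  - rewrite LKE !zlift eE; have := LK0 i'; have := LK0 k'; lra.
  - by rewrite dotBC lE -[pt l - _]opprB dotNr; ring.
  - exact: lE.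
  - by rewrite !subrr dot0r mul0r.
apply/inf_isometriesP => i k; apply/eqP/dot_eq0.
have colz j : col j (u - e *m z^T) = col j u - z j 0 *: e.
  by apply/colP => r; rewrite !mxE big_ord1 !mxE mulrC.
by rewrite !colz -[RHS](subrr ((z i 0 - z k 0) * dot e (pt i - pt k)))
  -{1}edgeE !dotBl !dotZl; ring.
Qed.

End Barycentric.

(** * Continuity of the forms in the position of [x] *)

Section MatrixContinuity.
Variables (R : realType) (T : topologicalType).

Lemma mulmx_entry_continuous a b c (f : T -> 'M[R]_(a, b)) (g : T -> 'M[R]_(b, c)) :
    (forall i j, continuous (fun x => f x i j)) ->
    (forall i j, continuous (fun x => g x i j)) ->
  forall i j, continuous (fun x => (f x *m g x) i j).
Proof.
move=> fc gc i j.
rewrite (_ : (fun x => _) = fun x => \sum_k f x i k * g x k j); last first.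
  by apply/funext => x; rewrite mxE.
apply: continuous_big => [|k _ x]; first exact: add_continuous.
by apply: cvgM; [exact: fc|exact: gc].
Qed.

Lemma cst_entry_continuous a b (A : 'M[R]_(a, b)) i j :
  continuous (fun _ : T => A i j).
Proof. by move=> x; exact: cvg_cst. Qed.

Lemma linear_form_continuous m (L : 'rV[R]_m) (t : T -> 'cV[R]_m) :
    (forall i j, continuous (fun x => t x i j)) ->
  continuous (fun x => linear_form L (t x)).
Proof.
move=> tc; apply: (mulmx_entry_continuous (f := fun=> L)) => //.
exact: cst_entry_continuous.
Qed.

Lemma quad_form_continuous m (G : 'M[R]_m) (t : T -> 'cV[R]_m) :
    (forall i j, continuous (fun x => t x i j)) ->
  continuous (fun x => quad_form G (t x)).
Proof.
move=> tc; apply: mulmx_entry_continuous => // i j.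
apply: mulmx_entry_continuous => [{}i {}j|]; last exact: cst_entry_continuous.
rewrite (_ : (fun x => _) = fun x => t x j i) //.
by apply/funext => x; rewrite mxE.
Qed.

End MatrixContinuity.

Lemma bary_continuous (R : realType) n (p : 'M[R]_(n, n.+2)) l i j :
  continuous (fun x => bary p l x i j).
Proof.
apply: (mulmx_entry_continuous
  (g := fun x : 'cV[R]_n => (col_mx 1 x : 'M[R]_(1 + n, 1)))).
  exact: cst_entry_continuous.
move=> {}i {}j; case: (split_ordP i) => k ->.
  rewrite (_ : (fun x => _) = fun=> (1 : 'M[R]_1) k j); first exact: cst_entry_continuous.
  by apply/funext => x; rewrite col_mxEu.
rewrite (_ : (fun x => _) = fun x : 'cV[R]_n => x k j); first exact: coord_continuous.
by apply/funext => x; rewrite col_mxEd.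
Qed.

Lemma outer_eq0 (F : fieldType) a b (c : 'cV[F]_a) (z : 'cV[F]_b) :
  c *m z^T = 0 -> z != 0 -> c = 0.
Proof.
move=> cz /cV0Pn[i zi]; apply/colP => r; apply/eqP.
have /matrixP/(_ r i)/eqP := cz.
by rewrite !mxE big_ord1 !mxE mulf_eq0 (negPf zi) orbF.
Qed.

(** * Admissible planes *)

Section Admissible.
Variables (R : realType) (n : nat) (p : 'M[R]_(n, n.+2)) (l : 'I_n.+2).
Local Notation P := (col' l p : 'M[R]_(n, n.+1)).
Hypothesis H_unit :
  (col_mx (const_mx 1 : 'rV[R]_n.+1) P : 'M[R]_n.+1) \in unitmx.
Variable S : {vspace 'M[R]_(n, n.+2)}.
Hypotheses (S_dim : \dim S = 2%N) (S_adm : p_admissible p S).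

Let L := bary_linear p l.
Let G := bary_quad p l.
Let D u v t : R := quad_form (G u) t * linear_form (L v) t
             - quad_form (G v) t * linear_form (L u) t.

Lemma bary_pencil u v x : u \in S -> v \in S -> D u v (bary p l x) = 0.
Proof.
move=> uS vS; set t := fun x => bary p l x; rewrite -/(t x).
have [U [_ Udense US]] := S_adm.2.
have DU y : U y -> D u v (t y) = 0.
  case/US => w [b [wS w0 flex]].
  have flex' i : dot (col i w - b) (col i p - y) = 0 by rewrite /dot flex mxE.
  have Lw := flex_bary_linear H_unit flex'.
  have Gw := flex_bary_quad H_unit flex'.
  have [w' _ Sw'] := plane_coord S_dim wS w0.
  (* Both forms of the flexing motion [w] vanish at [y], so modulo [w] every pair of values is a
     multiple of that of [w']; hence the determinant [D] is zero. *)
  have ev z : z \in S -> exists c,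
      quad_form (G z) (t y) = c * quad_form (G w') (t y) /\
      linear_form (L z) (t y) = c * linear_form (L w') (t y).
    case/Sw' => a [c ->]; exists c.
    rewrite addrC -[a *: w]addr0 /G /L !linearP !linear0.
    by rewrite !linear_formDl !quad_formDl Lw Gw linear_form0 quad_form0 !mulr0 !addr0.
  have [c [Gu Lu]] := ev _ uS; have [c' [Gv Lv]] := ev _ vS.
  rewrite /D Gu Lu Gv Lv; ring.
have Dcont : continuous (fun y => D u v (t y)).
  have t_cont := @bary_continuous _ _ p l.
  have Gc w := quad_form_continuous (G := G w) t_cont.
  have Lc w := linear_form_continuous (L := L w) t_cont.
  have GLc w w' : continuous (fun y => quad_form (G w) (t y) * linear_form (L w') (t y)).
    by move=> y; exact: (cvgM (Gc w y) (Lc w' y)).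
  by move=> y; exact: (cvgB (GLc u v y) (GLc v u y)).
apply/eqP; apply: contraT => Dx.
(* The open set where [D] is non-zero would, if non-empty, meet the dense set [U]. *)
have Oopen : open ((fun y => D u v (t y)) @^-1` ~` [set 0]).
  apply: open_comp => [y _|]; first exact: Dcont.
  by apply: closed_openC; exact: closed_eq.
have [|y [/= Dy Uy]] := Udense _ _ Oopen; first by exists x; exact/eqP.
by case: Dy; exact: DU.
Qed.

Lemma bary_unique (t : 'cV[R]_n.+1) : \sum_j t j 0 = 1 -> t = bary p l (P *m t).
Proof.
move=> t1; rewrite -[t in LHS](mulKmx H_unit); congr (_ *m _).
suff : (col_mx (const_mx 1) P : 'M[R]_(1 + n, n.+1)) *m t =
   col_mx 1 (P *m t) by [].
rewrite mul_col_mx; congr col_mx; apply/matrixP => i j.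
rewrite !ord1 !mxE eqxx mulr1n -[RHS]t1; apply: eq_bigr => k _.
by rewrite mxE mul1r.
Qed.

(** [D] is homogeneous of degree three, so scaling reduces a non-zero coordinate sum to sum one; the
    remaining vectors are reached along a line. *)
Lemma form_pencil u v (t : 'cV[R]_n.+1) : u \in S -> v \in S -> D u v t = 0.
Proof.
move=> uS vS.
have scale (s : 'cV[R]_n.+1) x : D u v (x *: s) = x ^+ 3 * D u v s.
  by rewrite /D !quad_formZ !linear_formZ; ring.
have D1 (s : 'cV[R]_n.+1) : \sum_j s j 0 != 0 -> D u v s = 0.
  move=> s0; set c := \sum_j _ in s0.
  have -> : s = c *: (c^-1 *: s) by rewrite scalerA mulfV // scale1r.
  rewrite scale (@bary_unique (c^-1 *: s)) ?bary_pencil ?mulr0 //.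
  by under eq_bigr => j _ do rewrite mxE; rewrite -mulr_sumr mulVf.
have [t0|/D1//] := eqVneq (\sum_j t j 0) 0.
have Dx x : x != 0 -> D u v (t + x *: bary p l 0) = 0.
  move=> x0; apply: D1.
  under eq_bigr => j _ do rewrite mxE [X in _ + X]mxE.
  rewrite big_split /= -mulr_sumr t0 add0r.
  by rewrite (sum_bary H_unit) mulr1.
(* A cubic in [x] with four zeros has zero constant term [D u v t]. *)
have := Dx 1; have := Dx (-1); have := Dx 2; have := Dx (-2).
rewrite !oppr_eq0 oner_eq0 pnatr_eq0.
rewrite /D !quad_formD !linear_formD.
move=> /(_ isT) E1 /(_ isT) E2 /(_ isT) E3 /(_ isT) E4.
nra.
Qed.

(** The factorisation holds with [K = 0], and the rank-one correction is zero because
    [u *m dep = 0]. *)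
Lemma isometry_of_forms u : L u = 0 -> (forall t, quad_form (G u) t = 0) ->
  u \in inf_isometries p.
Proof.
move=> Lu Gu; have := @edge_form_rank1 _ _ p l H_unit u 0.
rewrite (bary_linear_eq0 H_unit Lu) mul0mx subr0; apply => t.
by rewrite Gu -/L Lu /linear_form !mul0mx mxE mul0r.
Qed.

Lemma S_isometry0 u : u \in S -> u \in inf_isometries p -> u = 0.
Proof.
move=> uS uI; have : u \in (S :&: inf_isometries p)%VS by rewrite memv_cap uS.
by rewrite S_adm.1 memv0 => /eqP.
Qed.

Lemma affine_or_rank1 :
  (forall u, u \in S -> affine_motion p u) \/
  (exists (S' : {vspace 'M[R]_(n, n.+2)}) (E : {vspace 'cV[R]_n})
          (z : 'cV[R]_n.+2),
     [/\ p_equivalent p S S', \dim E = 2%N &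
         [set` S'] = [set c *m z^T | c in [set` E]]]).
Proof.
have [L0|] := pselect (forall u, u \in S -> L u = 0).
  left=> u uS; apply: (affine_motion_dep H_unit).
  exact/(bary_linear_eq0 H_unit)/L0.
move=> /existsNP[a /not_implyP[aS /eqP La]]; right.
have [K KP] : exists K, forall u t, u \in S ->
    quad_form (G u) t = linear_form (L u) t * linear_form K t.
  apply: (@pencil_factor _ _ _ S G L a) => //.
    by move=> u uS Lu Gu; apply: S_isometry0 => //; exact: isometry_of_forms.
  by move=> u v t uS vS; apply/eqP; rewrite -subr_eq0; apply/eqP/form_pencil.
pose z : 'cV[R]_n.+2 := \col_i oapp (fun j => K 0 j)
        (linear_form K (bary p l (col l p)) - 1) (unlift l i).
pose d := dep p l.
have uz u : u \in S -> u - (u *m d) *m z^T \in inf_isometries p.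
  by move=> uS; apply: (edge_form_rank1 H_unit) => t; exact: KP.
(* If the entries off [l] vanish then [K = 0], and [z_l] is [-1]. *)
have z0 : z != 0.
  apply/eqP => z0.
  have K0 : K = 0.
    by apply/rowP => j; have /colP/(_ (lift l j)) := z0; rewrite !mxE liftK.
  have /colP/(_ l) := z0; rewrite !mxE unlift_none /= K0 /linear_form mul0mx mxE.
  by move/eqP; rewrite sub0r oppr_eq0 oner_eq0.
pose f : 'Hom('M[R]_(n, n.+2), 'cV[R]_n) := linfun (mulmxr d).
pose h : 'Hom('cV[R]_n, 'M[R]_(n, n.+2)) := linfun (mulmxr z^T).
have fE u : f u = u *m d by rewrite lfunE.
have hE c : h c = c *m z^T by rewrite lfunE.
pose E := (f @: S)%VS.
(* An element of [S] killed by [dep] is congruent to zero modulo the isometries, hence zero by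
   admissibility. *)
have fS : \dim E = 2%N.
  rewrite -S_dim limg_dim_eq //; apply/eqP; rewrite -subv0.
  apply/subvP => u; rewrite memv_cap memv_ker fE => /andP[uS /eqP ud].
  by rewrite memv0 (S_isometry0 uS) //; have := uz u uS; rewrite ud mul0mx subr0.
have hI : lker h == 0%VS.
  apply/lker0P => b c; rewrite !hE => /eqP.
  rewrite -subr_eq0 -mulmxBl => /eqP bc.
  by apply/eqP; rewrite -subr_eq0; apply/eqP/(outer_eq0 bc).
exists (h @: E)%VS, E, z; split=> //; last first.
  apply/seteqP; split=> [_ /memv_imgP[c cE ->]|_ [c cE <-]] /=.
    by exists c; rewrite ?hE.
  by rewrite -hE memv_img.
split; first by rewrite limg_dim_eq ?fS //; move/eqP: hI => ->; rewrite capv0.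
have cls u v : u - v \in inf_isometries p ->
    isometry_class p u = isometry_class p v.
  move=> uv; apply/seteqP; split=> w; rewrite /isometry_class /= => wI.
    by rewrite -(subrKA u) rpredD.
  by rewrite -(subrKA v) rpredD // -opprB rpredN.
apply/seteqP; split=> _ [u uS <-].
  exists (h (f u)); first by rewrite /= !memv_img.
  by apply/esym/cls; rewrite hE fE; exact: uz.
case/memv_imgP: uS => _ /memv_imgP[v vS ->] ->.
by exists v => //; apply: cls; rewrite hE fE; exact: uz.
Qed.

End Admissible.

(** * Five points in space *)

(** A row [(a, b)] killing the matrix satisfies [a + b p_i = 0] for [i != l]. The columns of [r]
    force [b = - a h] with [h = 1^T r^-1], and the point [k], off the plane [h x = 1], forces
    [a = 0]. *)
Lemma bary_matrix_unit (R : fieldType) (p : 'M[R]_(3, 5)) (r : 'M[R]_3)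
    (f : 'I_3 -> 'I_5) (l k : 'I_5) :
    r = colsub f p -> r \in unitmx -> (forall j, f j != l) -> k != l ->
    ((const_mx 1 : 'rV[R]_3) *m invmx r *m p) 0 k != 1 :> R ->
  (col_mx (const_mx 1 : 'rV[R]_4) (col' l p : 'M[R]_(3, 4)) : 'M[R]_4) \in unitmx.
Proof.
move=> rE r_inv fl kl hk; rewrite -row_free_unit; apply: inj_row_free => v.
have [a [b vE]] : exists (a : 'rV[R]_1) (b : 'rV[R]_3), v = row_mx a b.
  exists (lsubmx (v : 'rV[R]_(1 + 3))), (rsubmx (v : 'rV[R]_(1 + 3))).
  by rewrite hsubmxK.
rewrite [in X in X -> _]vE => vH.
have /rowP{}vH : a *m const_mx 1 + b *m col' l p = 0 :> 'rV[R]_4.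
  by rewrite -mul_row_col.
have abp i : i != l -> a 0 0 + (b *m p) 0 i = 0.
  case: (unliftP l i) => [j ->|->]; last by rewrite eqxx.
  move=> _; have := vH j; rewrite !mxE big_ord1 mxE mulr1 => vHj; rewrite -[RHS]vHj.
  by congr (_ + _); apply: eq_bigr => s _; rewrite !mxE.
have bE : b = - a 0 0 *: ((const_mx 1 : 'rV[R]_3) *m invmx r).
  rewrite scalemxAl; apply: (canRL (mulmxK r_inv)); apply/rowP => j.
  have /eqP := abp _ (fl j); rewrite addrC addr_eq0 => /eqP abj.
  rewrite [RHS]mxE [const_mx _ _ _]mxE mulr1 -abj.
  by rewrite rE !mxE; apply: eq_bigr => s _; rewrite !mxE.
have a0 : a 0 0 = 0.
  have /eqP := abp _ kl; rewrite bE -scalemxAl [X in _ + X]mxE mulNr.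
  rewrite -{1}[a 0 0]mulr1 -mulrBr mulf_eq0 subr_eq0 [1 == _]eq_sym (negPf hk).
  by rewrite orbF => /eqP.
rewrite vE bE a0 oppr0 scale0r.
by rewrite [a]mx11_scalar a0 raddf0 row_mx0.
Qed.

Theorem theorem14 (R : realType) (p : 'M[R]_(3, 5)) (q r : 'M[R]_3)
    (S : {vspace 'M[R]_(3, 5)})
    (hq : q = colsub (tnth [tuple inord 0; inord 3; inord 4]) p)
    (hr : r = colsub (tnth [tuple inord 0; inord 1; inord 2]) p)
    (q_inv : q \in unitmx) (r_inv : r \in unitmx)
    (hqr : (invmx r *m q)^T *m const_mx 1 <> const_mx 1 :> 'cV[R]_3)
    (S_dim : \dim S = 2%N) (S_adm : p_admissible p S) :
  (forall u, u \in S -> affine_motion p u) \/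
  (exists (S' : {vspace 'M[R]_(3, 5)}) (E : {vspace 'cV[R]_3}) (z : 'cV[R]_5),
     [/\ p_equivalent p S S', \dim E = 2%N &
         [set` S'] = [set c *m z^T | c in [set` E]]]).
Proof.
set s := tnth _ in hr.
have s_val j : s j = j :> nat.
  by rewrite /s; case: j => [[|[|[|//]]] ?]; rewrite (tnth_nth 0) /= inordK.
(* [h x = 1] is the plane through [p_1], [p_2], [p_3]. *)
set h := (const_mx 1 : 'rV[R]_3) *m invmx r.
suff [l [k [sl kl hk]]] : exists l k : 'I_5,
    [/\ forall j, s j != l, k != l & (h *m p) 0 k != 1].
  exact: (affine_or_rank1 (bary_matrix_unit hr r_inv sl kl hk) S_dim S_adm).
have h_colsub (f : 'I_3 -> 'I_5) j : (h *m colsub f p) 0 j = (h *m p) 0 (f j).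
  by rewrite mxE [RHS]mxE; apply: eq_bigr => i _; rewrite [colsub _ _ _ _]mxE.
have hs j : (h *m p) 0 (s j) = 1.
  rewrite -h_colsub -hr mulmxKV //. by rewrite mxE.
(* Transposed, [hqr] says that some column of [q] is off this plane. *)
have [j] : exists j, (h *m q) 0 j != 1.
  apply: contrapT => /forallNP q1; apply: hqr; apply: trmx_inj.
  rewrite trmx_mul trmxK trmx_const mulmxA; apply/rowP => j; rewrite [RHS]mxE.
  by apply/eqP/negPn/negP; exact: q1.
have sP (l : 'I_5) : (2 < l)%N -> forall j, s j != l.
  move=> l2 i; apply: contraTneq l2 => <-; rewrite s_val -leqNgt -ltnS.
  exact: ltn_ord.
(* The first column of [q] is [p_1], on the plane; so [p_4] or [p_5] is off it, and the other of the
   two is taken as [p_l]. *)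
rewrite hq h_colsub; case: j => [[|[|[|//]]] ?]; rewrite (tnth_nth 0) /= => hk.
- case/eqP: hk; exact: hs 0.
- exists (inord 4), (inord 3); split=> //; last by rewrite -val_eqE /= !inordK.
  by apply: sP; rewrite inordK.
- exists (inord 3), (inord 4); split=> //; last by rewrite -val_eqE /= !inordK.
  by apply: sP; rewrite inordK.
Qed.
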